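(* Let $\Sigma$ be a planar model. For any $\varepsilon,C,\rho>0$ there exists $N_\varepsilon=N(\varepsilon,C,\rho)$ such that: if $\omega\in\Omega$ and $k\in\mathbb N$ are such that $\eta^{(T^{k'(\omega)}\omega)}$ is $(C,\rho)$-Frostman on tubes, and $n=k'(\omega)+N_\varepsilon$, then $$\mathbf P_{i=k}\big(d_{TV}(\eta^{(\omega)}_{x,i},\ \eta^{(\omega)}_{n,[x,i]})<\varepsilon\big)>1-\varepsilon,$$ where $d_{TV}$ is the total variation distance.
   Context: Planar model $\Sigma$: $I$ finite; $f^{(i)}_j(z)=\lambda_iz+t^{(i)}_j$, $\lambda_i=r_i\varphi_i$, $0<r_i<1$; positive probability vectors $p_i$; $\Omega=I^{\mathbb N}$, $T$ the shift. For $u\in\mathbb X^{(\omega)}_n=\prod_{j\le n}\{1,\dots,k_{\omega_j}\}$, $f^{(\omega)}_u=f^{(\omega_1)}_{u_1}\circ\dots\circ f^{(\omega_n)}_{u_n}$, $p^{(\omega)}_u=\prod_jp^{(\omega_j)}_{u_j}$. $\eta^{(\omega)}$ is the law of $\sum_{n\ge1}(\prod_{j<n}\lambda_{\omega_j})t^{(\omega_n)}_{u_n}$, $u_n$ independent with laws $p_{\omega_n}$. Fix $R>0$ with $\overline{f^{(i)}_j(B(0,R))}\subset B(0,R)$ and $2R\min r_i>1/2$; $B^{(\omega)}_u=f^{(\omega)}_u(B(0,R))$; $k'(\omega)$ is the natural number with $2R\prod_{i=1}^{k'}r_{\omega_i}\le2^{-k}\le2R\prod_{i=1}^{k'-1}r_{\omega_i}$.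 Raw component: $\mu_{x,i}=\mu|_D/\mu(D)$ for $D=D_i(x)$ the dyadic square of side $2^{-i}$ containing $x$; $\mathbf P_{i=k}(\mu_{x,i}\in A)=\mu(\{x:\mu_{x,k}\in A\})$. Truncated component: for $D\in\mathcal D_k$ and $n>k$, $\eta^{(\omega)}_{n,[D]}=Z^{-1}\sum_{u\in\mathbb X^{(\omega)}_n,\ B^{(\omega)}_u\subset D}p^{(\omega)}_uf^{(\omega)}_u\eta^{(T^n\omega)}$ with $Z$ normalizing, and $\eta^{(\omega)}_{n,[x,k]}=\eta^{(\omega)}_{n,[D_k(x)]}$. $\mu$ is $(C,\rho)$-Frostman on tubes if $\mu(B(W+x,r))\le Cr^\rho$ for all lines $W$ through $0$, $x\in\mathbb R^2$, $r>0$. *)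

(* Defs.v *)
From HB Require Import structures.
From mathcomp Require Import all_boot all_order all_algebra.
From mathcomp Require Import all_classical all_reals all_analysis.
Set Implicit Arguments. Unset Strict Implicit. Unset Printing Implicit Defensive.
Import Order.TTheory GRing.Theory Num.Theory.
Import numFieldNormedType.Exports.
Local Open Scope classical_set_scope.
Local Open Scope ring_scope.

Section Planar.
Variable R : realType.

(* The plane R^2 = C, points as pairs (real part, imaginary part). *)
Definition cmul (a b : R * R) : R * R :=
  (a.1 * b.1 - a.2 * b.2, a.1 * b.2 + a.2 * b.1).
Definition cadd (a b : R * R) : R * R := (a.1 + b.1, a.2 + b.2).
Definition cnorm (a : R * R) : R := Num.sqrt (a.1 ^+ 2 + a.2 ^+ 2).

Definition eball (c : R * R) (r : R) : set (R * R) :=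
  [set z | cnorm (z.1 - c.1, z.2 - c.2) < r].

Variable I : finType.
Variables (K : I -> nat) (lam : I -> R * R) (t : I -> nat -> R * R)
          (p : I -> nat -> R).

(* f^{(i)}_j (z) = lambda_i z + t^{(i)}_j  (maps indexed by j < K i) *)
Definition fmap (i : I) (j : nat) (z : R * R) : R * R :=
  cadd (cmul (lam i) z) (t i j).

Definition rr (i : I) : R := cnorm (lam i).

(* shift: (T^n omega)_j = omega_{j+n}; omega_1 of the paper is omega 0 *)
Definition shiftn (n : nat) (om : nat -> I) : nat -> I := fun j => om (j + n)%N.

Fixpoint words (om : nat -> I) (n : nat) : seq (seq nat) :=
  match n with
  | 0 => [:: [::]]
  | n'.+1 => [seq rcons s j | s <- words om n', j <- iota 0 (K (om n'))]
  end.

Fixpoint fword (om : nat -> I) (u : seq nat) (n : nat) : R * R -> R * R :=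
  match n with
  | 0 => id
  | n'.+1 => fun z => fword om u n' (fmap (om n') (nth 0%N u n') z)
  end.
Definition fu (om : nat -> I) (u : seq nat) := fword om u (size u).

Definition pu (om : nat -> I) (u : seq nat) : R :=
  \prod_(j < size u) p (om j) (nth 0%N u j).

Definition pe (i : I) (a : nat) : R := if (a < K i)%N then p i a else 0.

Fixpoint lamprod (om : nat -> I) (m : nat) : R * R :=
  match m with
  | 0 => (1, 0)
  | m'.+1 => cmul (lamprod om m') (lam (om m'))
  end.

Definition Yterm (om : nat -> I) (a : nat -> nat) (m : nat) : R * R :=
  cmul (lamprod om m) (t (om m) (a m)).
Definition Yseries (om : nat -> I) (a : nat -> nat) : R * R :=
  (limn (@series R (fun m => (Yterm om a m).1) : R^nat),
   limn (@series R (fun m => (Yterm om a m).2) : R^nat)).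

(* nu is eta^{(omega)}: the law of the random series, where u_1, u_2, ...
   are independent with laws p_{omega_1}, p_{omega_2}, ...  *)
Definition is_eta (om : nat -> I) (nu : set (R * R) -> \bar R) : Prop :=
  exists (d : measure_display) (T : measurableType d) (P : probability T R)
         (u : nat -> T -> nat),
    (forall n a, measurable [set x | u n x = a]) /\
    (forall n (a : nat -> nat),
        P [set x | forall j, (j < n)%N -> u j x = a j] =
        (\prod_(j < n) pe (om j) (a j))%:E) /\
    (forall A : set (R * R), measurable A ->
        nu A = P [set x | Yseries om (fun j => u j x) \in A]).

Definition is_kprime (Rad : R) (om : nat -> I) (k kp : nat) : Prop :=
  2 * Rad * \prod_(j < kp) rr (om j) <= 2 ^- k /\
  forall kq, (kq < kp)%N -> 2 ^- k < 2 * Rad * \prod_(j < kq) rr (om j).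

Definition line0 (w : R * R) : set (R * R) := [set (s * w.1, s * w.2) | s in [set: R]].
Definition tube (w x : R * R) (r : R) : set (R * R) :=
  [set y | exists2 z, z \in line0 w & y \in eball (cadd z x) r].
Definition frostman_tubes (C rho : R) (mu : set (R * R) -> \bar R) : Prop :=
  forall (w x : R * R) (r : R), w != (0, 0) -> 0 < r ->
    (mu (tube w x r) <= (C * r `^ rho)%:E)%E.

(* dyadic square of side 2^-i containing x (half-open [a,a+1)2^-i x [b,b+1)2^-i) *)
Definition dyadic (i : nat) (x : R * R) : set (R * R) :=
  [set y | Num.floor (y.1 * 2 ^+ i) = Num.floor (x.1 * 2 ^+ i) /\
           Num.floor (y.2 * 2 ^+ i) = Num.floor (x.2 * 2 ^+ i)].

(* raw component mu_D = mu|_D / mu(D)  (the zero set function if mu(D) = 0) *)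
Definition rawcomp (mu : set (R * R) -> \bar R) (D : set (R * R)) : set (R * R) -> R :=
  fun A => fine (mu (A `&` D)) / fine (mu D).

(* truncated component eta^{(omega)}_{n,[D]} (zero set function if Z = 0) *)
Definition trunccomp (eta : (nat -> I) -> set (R * R) -> \bar R) (Rad : R)
    (om : nat -> I) (n : nat) (D : set (R * R)) : set (R * R) -> R :=
  fun A =>
    (\sum_(u <- words om n | `[< fu om u @` eball (0, 0) Rad `<=` D >])
        pu om u * fine (eta (shiftn n om) (fu om u @^-1` A)))
    / (\sum_(u <- words om n | `[< fu om u @` eball (0, 0) Rad `<=` D >]) pu om u).

Definition dTV (mu nu : set (R * R) -> R) : R :=
  sup [set `|mu A - nu A| | A in [set A : set (R * R) | measurable A]].

Definition planar_model (Rad : R) : Prop :=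
  (forall i, (0 < K i)%N) /\
  (forall i, 0 < rr i < 1) /\
  (forall i, (forall j, (j < K i)%N -> 0 < p i j) /\ \sum_(j < K i) p i j = 1) /\
  0 < Rad /\
  (forall i j, (j < K i)%N ->
     closure (fmap i j @` eball (0, 0) Rad) `<=` eball (0, 0) Rad) /\
  (forall i, 1 / 2 < 2 * Rad * rr i).

End Planar.

(* Main.v *)
Require Import Defs.
From HB Require Import structures.
From mathcomp Require Import all_boot all_order all_algebra.
From mathcomp Require Import all_classical all_reals all_analysis.
From mathcomp Require Import measurable_realfun ring lra.
Import Order.TTheory GRing.Theory Num.Theory.
Import numFieldNormedType.Exports.
Local Open Scope classical_set_scope.
Local Open Scope ring_scope.
Set Implicit Arguments. Unset Strict Implicit. Unset Printing Implicit Defensive.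

(** Realize [eta om] as the image, under the coding map [Y], of the product law [P] on
    digit sequences [b], and write [v_n] for the prefix of [b] of length [n]. The
    truncated component of a dyadic square [D] is the law of [Y] conditioned on
    [B_(v_n) <= D], while the raw component is the law of [Y] conditioned on
    [Y \in D]. The first event is almost surely contained in the second, so the two
    conditional laws are at total variation distance at most
    [P(Y \in D, not B_(v_n) <= D) / P(Y \in D)]. By Markov's inequality over the
    squares, those where this exceeds [eps] have total mass at most
    [P(B_(v_n) meets two dyadic squares) / eps].

    A disc [B_(v_n)] meeting two squares crosses a grid line. The larger disc
    [B_(v_k')] has diameter at most [2^-k], so given [v_k'] there is only one
    candidate line per direction, and pulling the strip of width [2^-k * q^N] around
    it back by [f_(v_k')] gives a tube of width [O(q^N)], of measure [O(q^(N rho))]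
    for [eta (T^k' om)] by the Frostman hypothesis and independence of the digits. *)

Lemma measurable_preimage d d' (T : measurableType d) (T' : measurableType d')
    (f : T -> T') (A : set T') :
  measurable_fun setT f -> measurable A -> measurable (f @^-1` A).
Proof. by move=> mf mA; rewrite -[X in measurable X]setTI; exact: mf. Qed.

Section CountableFibers.
Context {d : measure_display} {T : measurableType d} {R : realType}.
Variables (Z : countType) (c : T -> Z).
Hypothesis measurable_fiber : forall z, measurable (c @^-1` [set z]).

Lemma measurable_countable_preimage (B : set Z) : measurable (c @^-1` B).
Proof.
rewrite -[B]image_id -bigcup_imset1 preimage_bigcup bigcup_mkcond.
by apply: countable_bigcupT_measurable => [|z]; [exact: countableP|case: ifP].
Qed.

Lemma measure_fin_fibers (mu : {measure set T -> \bar R}) E (s : seq Z) :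
  measurable E -> uniq s ->
  mu (E `&` c @^-1` [set` s]) = (\sum_(z <- s) mu (E `&` c @^-1` [set z]))%E.
Proof.
move=> mE us; rewrite fsbig_seq // -measure_fin_bigcup //.
- by rewrite -setI_bigcupr -preimage_bigcup bigcup_imset1 image_id.
- exact/trivIset_setIl/trivIset_preimage1.
- by move=> z _; exact: measurableI.
Qed.

Lemma le_measure_fibers (mu nu : {measure set T -> \bar R}) (A B : set T) :
  measurable A -> measurable B ->
  (forall z, mu (A `&` c @^-1` [set z]) <= nu (B `&` c @^-1` [set z]))%E ->
  (mu A <= nu B)%E.
Proof.
move=> mA mB AB; pose fiber i := (pickle \o c) @^-1` [set i].
have mfiber i : measurable (fiber i).
  by rewrite /fiber comp_preimage; exact: measurable_countable_preimage.
have measure_sum (m : {measure set T -> \bar R}) E : measurable E ->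
    m E = (\sum_(i <oo) m (E `&` fiber i))%E.
  move=> mE; have cover : \bigcup_i (E `&` fiber i) = E.
    by rewrite -setI_bigcupr -preimage_bigcup bigcup_imset1 image_id setIT.
  rewrite -measure_semi_bigcup ?cover // => [i|]; first exact: measurableI.
  exact/trivIset_setIl/trivIset_preimage1.
rewrite (measure_sum mu A) // (measure_sum nu B) //.
apply: lee_nneseries => // i _.
have [[z zi]|noz] := pselect (exists z : Z, pickle z = i).
  have -> // : fiber i = c @^-1` [set z].
  by apply/seteqP; split=> x /=; rewrite /fiber /= -zi;
    [exact: (pcan_inj pickleK)|move=> ->].
have -> : fiber i = set0 by apply/seteqP; split=> // x xi; apply: noz; exists (c x).
by rewrite !setI0 !measure0.
Qed.

End CountableFibers.

Lemma le_measure_ae d (T : measurableType d) (R : realType)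
    (mu : {measure set T -> \bar R}) (A B : set T) :
  measurable A -> measurable B -> (\forall x \ae mu, A x -> B x) ->
  (mu A <= mu B)%E.
Proof.
move=> mA mB [N [mN muN0 AB]]; rewrite -(measureU0 mB mN muN0).
apply: le_measure; rewrite ?inE //; first exact: measurableU.
by move=> x Ax; have [Bx|nBx] := pselect (B x); [left|right; apply: AB => /(_ Ax)].
Qed.

Lemma conditional_ratio_dist (R : realFieldType) (x s g d : R) :
  0 <= s <= g -> s <= x -> x - s <= d - g -> g <= d ->
  `|x / d - s / g| <= (d - g) / d.
Proof.
move=> /andP[s0 sg] sx xs gd.
have [g_gt0|g_le0] := ltP 0 g; last first.
  have [-> ->] : s = 0 /\ g = 0 by lra.
  have [x0 xd] : 0 <= x /\ x <= d by lra.
  by rewrite mul0r !subr0 ger0_norm ?divr_ge0 ?ler_wpM2r ?invr_ge0 ?(le_trans x0).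
have d_gt0 : 0 < d by exact: lt_le_trans gd.
have -> : x / d - s / g = (((x - s) * g - s * (d - g)) / g) / d.
  by field; rewrite !gt_eqF.
rewrite !normrM !normfV (gtr0_norm d_gt0) (gtr0_norm g_gt0).
rewrite ler_pM2r ?invr_gt0 // ler_pdivrMr // ler_norml.
by apply/andP; split; nra.
Qed.

Section Conditioning.
Context {d : measure_display} {T : measurableType d} {R : realType}.
Variable mu : {measure set T -> \bar R}.
Hypothesis mu_fin : fin_num_fun mu.
Implicit Types A E G : set T.

Lemma fine_measureDI A E : measurable A -> measurable E ->
  fine (mu A) = fine (mu (A `\` E)) + fine (mu (A `&` E)).
Proof.
move=> mA mE; rewrite -fineD ?mu_fin -?measureDI //.
- exact: measurableD.
- exact: measurableI.
Qed.

Lemma le_fine_measure A E : measurable A -> measurable E -> A `<=` E ->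
  fine (mu A) <= fine (mu E).
Proof. by move=> mA mE AE; rewrite fine_le ?mu_fin ?le_measure ?inE. Qed.

Lemma conditional_measure_dist A E G :
  measurable A -> measurable E -> measurable G -> G `<=` E ->
  `|fine (mu (A `&` E)) / fine (mu E) - fine (mu (A `&` G)) / fine (mu G)| <=
    fine (mu (E `\` G)) / fine (mu E).
Proof.
move=> mA mE mG GE.
have mAE : measurable (A `&` E) by exact: measurableI.
have mAG : measurable (A `&` G) by exact: measurableI.
have muEG : fine (mu (E `\` G)) = fine (mu E) - fine (mu G).
  by rewrite (fine_measureDI mE mG) (setIidr GE) addrK.
rewrite muEG; apply: conditional_ratio_dist.
- by rewrite fine_ge0 //= le_fine_measure.
- by apply: le_fine_measure => //; exact: setIS.
- rewrite -muEG (fine_measureDI mAE mG) -setIA (setIidr GE) addrK.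
  by apply: le_fine_measure; [exact: measurableD..|apply: setSD; exact: subIsetr].
- exact: le_fine_measure.
Qed.

End Conditioning.

Lemma cvgn_natSinvP (R : realType) (h : R^nat) : cvgn h <->
  forall k, exists N, forall n, (N <= n)%N -> `|h N - h n| < k.+1%:R^-1.
Proof.
split=> [cvgh k|cauchyh].
  have half_gt0 : 0 < k.+1%:R^-1 / 2 :> R by rewrite divr_gt0 ?invr_gt0.
  have [N _ distN] := cvgr_dist_lt h (limn h) cvgh _ half_gt0.
  exists N => n Nn; rewrite -(subrKA (limn h)).
  apply: le_lt_trans (ler_normD _ _) _.
  by rewrite [ltRHS](splitr k.+1%:R^-1) distrC ltrD // distN //=.
apply: cauchy_cvg; apply: cauchy_exP => e e_gt0.
have [k] := ltr_add_invr e_gt0; rewrite add0r => k_lte.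
have [N distN] := cauchyh k; exists (h N), N => // n Nn /=.
exact: lt_trans (distN n Nn) _.
Qed.

Section MeasurableLimit.
Context {d : measure_display} {T : measurableType d} {R : realType}.

Lemma measurable_normB_lt (f g : T -> R) (r : R) :
  measurable_fun setT f -> measurable_fun setT g ->
  measurable [set x | `|f x - g x| < r].
Proof.
move=> mf mg; rewrite -[X in measurable X]setTI.
apply: (measurable_fun_ltr (f := fun x => `|f x - g x|) (g := cst r)) => //.
by apply: measurableT_comp => //; exact: measurable_funB.
Qed.

Lemma measurable_cvgn (h : nat -> T -> R) :
  (forall n, measurable_fun setT (h n)) -> measurable [set x | cvgn (h^~ x)].
Proof.
move=> mh; rewrite [X in measurable X](_ : _ = \bigcap_k \bigcup_N \bigcap_n
    [set x | (N <= n)%N -> `|h N x - h n x| < k.+1%:R^-1]); last first.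
  apply/seteqP; split=> x.
    move=> /cvgn_natSinvP cauchyx k _; have [N distN] := cauchyx k.
    by exists N => // n _; exact: distN.
  move=> cauchyx; apply/cvgn_natSinvP => k.
  by have [N _ distN] := cauchyx k I; exists N => n; exact: distN.
apply: bigcapT_measurable => k; apply: bigcupT_measurable => N.
apply: bigcapT_measurable => n; have [Nn|nN] := leqP N n.
  rewrite [X in measurable X](_ : _ = [set x | `|h N x - h n x| < k.+1%:R^-1]).
    exact: measurable_normB_lt.
  by apply/seteqP; split=> x //=; exact.
by rewrite [X in measurable X](_ : _ = setT) //; apply/seteqP; split.
Qed.

Lemma measurable_fun_limn (h : nat -> T -> R) :
  (forall n, measurable_fun setT (h n)) ->
  measurable_fun setT (fun x => limn (h^~ x)).
Proof.
move=> mh; pose C := [set x | cvgn (h^~ x)].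
apply: (@measurable_fun_cvg _ _ _ _ (fun n x => if x \in C then h n x else point)).
  move=> n; apply: measurable_fun_ifT => //.
  apply: (measurable_fun_bool true); rewrite setTI preimage_mem_true.
  exact: measurable_cvgn.
move=> x _; have [xC|xC] := pselect (C x); first by rewrite mem_set.
by rewrite memNset // dvgP //; exact: cvg_cst.
Qed.

End MeasurableLimit.

Lemma cvg_powR_geometric (R : realType) (q M rho : R) :
  0 <= q < 1 -> 0 <= M -> 0 < rho -> (q ^+ n * M) `^ rho @[n --> \oo] --> 0.
Proof.
move=> /andP[q_ge0 q_lt1] M_ge0 rho_gt0.
have -> : (fun n => (q ^+ n * M) `^ rho) = geometric (M `^ rho) (q `^ rho).
  apply/funext => n; rewrite powRM ?exprn_ge0 // mulrC /=; congr (_ * _).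
  by rewrite -[q ^+ n]powR_mulrn // -powRrM mulrC powRrM powR_mulrn ?powR_ge0.
apply: cvg_geometric; rewrite ger0_norm ?powR_ge0 //.
have := @gt0_ltr_powR R rho rho_gt0 q 1; rewrite powR1; apply => //.
by rewrite nnegrE.
Qed.

Lemma powR_geometric_lt (R : realType) (q M rho C e : R) :
  0 <= q < 1 -> 0 <= M -> 0 < rho -> 0 < e ->
  exists N : nat, C * (q ^+ N * M) `^ rho < e.
Proof.
move=> q01 M_ge0 rho_gt0 e_gt0.
have cvg0 : C * (q ^+ n * M) `^ rho @[n --> \oo] --> 0.
  rewrite -[X in _ --> X](mulr0 C).
  by apply: cvgM; [exact: cvg_cst|exact: cvg_powR_geometric].
have [N _ lt_e] := cvgr_lt _ cvg0 _ e_gt0.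
by exists N; exact: lt_e (leqnn N).
Qed.

Lemma measurable_floor_fiber d (T : measurableType d) (R : realType) (f : T -> R)
    (j : int) :
  measurable_fun setT f -> measurable [set z | Num.floor (f z) = j].
Proof.
move=> mf.
rewrite [X in measurable X](_ : _ = f @^-1` `[j%:~R, (j + 1)%:~R[%classic).
  exact: measurable_preimage.
by apply/seteqP; split=> z /=; rewrite in_itv /=;
  [move=> <-; exact: floor_itv|exact: floor_def].
Qed.

Section PlaneGeometry.
Context {R : realType}.
Implicit Types v w x y z : R * R.

Lemma cnorm_ge0 z : 0 <= cnorm z.
Proof. exact: sqrtr_ge0. Qed.

Lemma cnormM v z : cnorm (cmul v z) = cnorm v * cnorm z.
Proof.
rewrite /cnorm /cmul /= -sqrtrM; last by rewrite addr_ge0 ?sqr_ge0.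
by congr Num.sqrt; ring.
Qed.

Lemma cnorm_real (a : R) : cnorm (a, 0) = `|a|.
Proof. by rewrite /cnorm /= expr0n /= addr0 sqrtr_sqr. Qed.

Lemma cnorm_swap (a b : R) : cnorm (b, - a) = cnorm (a, b).
Proof. by rewrite /cnorm /= sqrrN addrC. Qed.

Lemma cnorm_gt0 v : (0 < cnorm v) = (v != (0, 0)).
Proof.
case: v => a b; rewrite sqrtr_gt0 lt_neqAle addr_ge0 ?sqr_ge0 // andbT eq_sym.
by rewrite paddr_eq0 ?sqr_ge0 // !sqrf_eq0 xpair_eqE.
Qed.

(* [`|z|] is the maximum norm of the product space [R * R]. *)
Lemma normr_le_cnorm z : `|z| <= cnorm z.
Proof.
rewrite prod_normE ge_max -!sqrtr_sqr /cnorm.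
by rewrite !ler_sqrt ?addr_ge0 ?sqr_ge0 // lerDl lerDr !sqr_ge0.
Qed.

Lemma normr_fst_le z : `|z.1| <= `|z|.
Proof. by rewrite prod_normE le_max lexx. Qed.

Lemma normr_snd_le z : `|z.2| <= `|z|.
Proof. by rewrite prod_normE le_max lexx orbT. Qed.

Lemma eball0E (r : R) z : eball (0, 0) r z <-> cnorm z < r.
Proof. by rewrite /eball /= !subr0. Qed.

Definition strip v (e r : R) : set (R * R) := [set z | `|(cmul v z).1 + e| < r].

Lemma strip_tube v (e r : R) : v != (0, 0) ->
  strip v e r = tube (v.2, v.1)
    (- (e / cnorm v ^+ 2 * v.1), e / cnorm v ^+ 2 * v.2) (r / cnorm v).
Proof.
rewrite -cnorm_gt0 => v_gt0; set q := e / _.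
have n2_neq0 : cnorm v ^+ 2 != 0 by rewrite expf_neq0 // gt_eqF.
have n2E : cnorm v ^+ 2 = v.1 ^+ 2 + v.2 ^+ 2.
  by rewrite sqr_sqrtr // addr_ge0 ?sqr_ge0.
have eE : e = q * (v.1 ^+ 2 + v.2 ^+ 2) by rewrite -n2E divfK.
have dist s z :
    cnorm v * cnorm (z - Defs.cadd (s * v.2, s * v.1) (- (q * v.1), q * v.2)) =
    cnorm ((cmul v z).1 + e, (cmul v z).2 - s * cnorm v ^+ 2).
  rewrite -cnormM n2E eE; congr cnorm; rewrite /cmul /Defs.cadd /=.
  by congr pair; ring.
apply/seteqP; split=> z.
  move=> zstrip; pose s := (cmul v z).2 / cnorm v ^+ 2.
  exists (s * v.2, s * v.1); apply/mem_set; first by exists s.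
  by rewrite /eball /= ltr_pdivlMr // mulrC dist divfK // subrr cnorm_real.
move=> [_ /set_mem[s _ <-] /set_mem]; rewrite /eball /= ltr_pdivlMr // mulrC dist.
exact/le_lt_trans/(le_trans (normr_fst_le (_, _)))/normr_le_cnorm.
Qed.

Lemma frostman_strip_le (C rho : R) (nu : set (R * R) -> \bar R) v e r :
  frostman_tubes C rho nu -> v != (0, 0) -> 0 < r ->
  (nu (strip v e r) <= (C * (r / cnorm v) `^ rho)%:E)%E.
Proof.
move=> frost v0 r_gt0; rewrite strip_tube //; apply: frost; last first.
  by rewrite divr_gt0 // cnorm_gt0.
by move: v0; case: v => a b; rewrite !xpair_eqE andbC.
Qed.

Definition nearest_dyadic (k : nat) (a : R) : R :=
  (Num.floor (a * 2 ^+ k + 1 / 2))%:~R / 2 ^+ k.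

Definition grid_cross (k : nat) (c : R * R) (r : R) : set (R * R) :=
  [set z | `|z.1 - nearest_dyadic k c.1| < r] `|`
  [set z | `|z.2 - nearest_dyadic k c.2| < r].

Lemma floor_half_between (a x y : R) :
  `|x - a| < 1 / 2 -> `|y - a| < 1 / 2 -> Num.floor x < Num.floor y ->
  x <= (Num.floor (a + 1 / 2))%:~R <= y.
Proof.
rewrite !ltr_norml => /andP[xa ax] /andP[ya ay].
rewrite -lezD1 -(ler_int R) => floor_xy.
have x_lt := floorD1_gt x; have le_y := floor_le y.
rewrite (@floor_def _ _ (Num.floor y)) ?intrD; last by apply/andP; split; lra.
by apply/andP; split; lra.
Qed.

Lemma dist_nearest_dyadic (k : nat) (a x y r s : R) : s <= 2 ^- k / 2 ->
  `|x - a| < s -> `|y - a| < s -> `|x - y| < r ->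
  Num.floor (x * 2 ^+ k) <> Num.floor (y * 2 ^+ k) ->
  `|x - nearest_dyadic k a| < r.
Proof.
move=> s_le xa ya xy floor_neq; have k_gt0 : 0 < 2 ^+ k :> R by rewrite exprn_gt0.
have scale u : `|u - a| < s -> `|u * 2 ^+ k - a * 2 ^+ k| < 1 / 2.
  move=> ua; rewrite -mulrBl normrM (gtr0_norm k_gt0) -ltr_pdivlMr //.
  by rewrite mul1r mulrC (lt_le_trans ua).
have between b c : `|b - a| < s -> `|c - a| < s ->
    Num.floor (b * 2 ^+ k) < Num.floor (c * 2 ^+ k) -> b <= nearest_dyadic k a <= c.
  move=> /scale ba /scale ca /(floor_half_between ba ca)/andP[b_le le_c].
  by rewrite ler_pdivlMr // b_le ler_pdivrMr.
move: xy; rewrite !ltr_norml => /andP[xy yx].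
have [lt_xy|lt_yx|//] := ltgtP (Num.floor (x * 2 ^+ k)) (Num.floor (y * 2 ^+ k)).
  by have /andP[? ?] := between _ _ xa ya lt_xy; apply/andP; split; lra.
by have /andP[? ?] := between _ _ ya xa lt_yx; apply/andP; split; lra.
Qed.

Lemma grid_cross_of_dyadic_neq (k : nat) (c x y : R * R) (r s : R) :
  s <= 2 ^- k / 2 -> `|x - c| < s -> `|y - c| < s -> `|x - y| < r ->
  ~ dyadic k x y -> grid_cross k c r x.
Proof.
move=> s_le xc yc xy /not_andP[] floor_neq; [left|right];
  apply: dist_nearest_dyadic s_le _ _ _ (nesym floor_neq);
  by [exact: le_lt_trans (normr_fst_le (_ - _)) _
     |exact: le_lt_trans (normr_snd_le (_ - _)) _].
Qed.

Lemma affine_grid_crossE k c g r v :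
  (fun z => Defs.cadd g (cmul v z)) @^-1` grid_cross k c r =
  strip v (g.1 - nearest_dyadic k c.1) r `|`
  strip (v.2, - v.1) (g.2 - nearest_dyadic k c.2) r.
Proof.
rewrite preimage_setU; congr (_ `|` _); apply/seteqP; split=> z;
  rewrite /strip /cmul /Defs.cadd /=; congr (`|_| < _); ring.
Qed.

Lemma measurable_affine v c : measurable_fun setT (fun z => Defs.cadd c (cmul v z)).
Proof.
rewrite /Defs.cadd /cmul /=; apply: measurable_fun_pair => /=;
  apply: measurable_funD => //;
  by [apply: measurable_funB; exact: measurable_funM
     |apply: measurable_funD; exact: measurable_funM].
Qed.

Lemma measurable_strip v e r : measurable (strip v e r).
Proof.
rewrite (_ : strip v e r = [set z | `|(cmul v z).1 - (- e)| < r]); last first.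
  by rewrite /strip opprK.
apply: (measurable_normB_lt (f := fun z => (cmul v z).1) (g := cst (- e))) => //.
have := measurableT_comp measurable_fst (measurable_affine v (0, 0)).
by apply: eq_measurable_fun => z _; rewrite /= add0r.
Qed.

Lemma affine_continuous v c : continuous (fun z => Defs.cadd c (cmul v z)).
Proof.
move=> z; rewrite /continuous_at /Defs.cadd /cmul /=.
by apply: (@cvg_pair _ _ _ _ (nbhs _) (nbhs _)) => /=; apply: cvgD;
  [exact: cvg_cst|apply: cvgB|exact: cvg_cst|apply: cvgD];
  (apply: cvgM; first exact: cvg_cst); solve [exact: cvg_fst|exact: cvg_snd].
Qed.

Definition cell (k : nat) (z : R * R) : int * int :=
  (Num.floor (z.1 * 2 ^+ k), Num.floor (z.2 * 2 ^+ k)).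

Lemma dyadicE k z : dyadic k z = cell k @^-1` [set cell k z].
Proof. by apply/seteqP; split=> y [y1 y2]; rewrite /dyadic /cell /= ?y1 ?y2. Qed.

Lemma measurable_cell k u : measurable (cell k @^-1` [set u]).
Proof.
rewrite [X in measurable X](_ : _ =
    [set z | Num.floor (z.1 * 2 ^+ k) = u.1] `&`
    [set z | Num.floor (z.2 * 2 ^+ k) = u.2]).
  by apply: measurableI; apply: measurable_floor_fiber; exact: measurable_funM.
by case: u => u1 u2; apply/seteqP; split=> z [/= z1 z2]; rewrite /cell /= ?z1 ?z2.
Qed.

End PlaneGeometry.

Definition cylinder (w : seq nat) : set (nat -> nat) :=
  [set b | mkseq b (size w) = w].

Definition cylinders : set (set (nat -> nat)) := [set set0] `|` range cylinder.

Local Notation codes := (g_sigma_algebraType cylinders).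

Definition shift_code (k : nat) (b : codes) : codes := fun j => b (j + k)%N.

Section CodeSpace.
Implicit Types (b : nat -> nat) (v w : seq nat).

Lemma mkseqD b m n : mkseq b (m + n) = mkseq b m ++ mkseq (shift_code m b) n.
Proof.
rewrite /mkseq iotaD map_cat; congr (_ ++ _).
rewrite add0n -{1}[m]addn0 iotaDl -map_comp.
by apply: eq_map => j /=; rewrite addnC.
Qed.

Lemma cylinder_nil : cylinder [::] = setT.
Proof. by apply/seteqP; split. Qed.

Lemma cylinderE w :
  cylinder w = [set b | forall j, (j < size w)%N -> b j = nth 0%N w j].
Proof.
apply/seteqP; split=> b /=.
  by move=> bw j jw; rewrite -[in RHS]bw nth_mkseq.
move=> bw; apply: (@eq_from_nth _ 0%N); rewrite size_mkseq // => j jw.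
by rewrite nth_mkseq // bw.
Qed.

Lemma cylinder_cat v w :
  cylinder (v ++ w) = cylinder v `&` shift_code (size v) @^-1` cylinder w.
Proof.
apply/seteqP; split=> b; rewrite /cylinder /= size_cat mkseqD; last first.
  by move=> [-> ->].
by move/eqP; rewrite eqseq_cat ?size_mkseq // => /andP[/eqP ? /eqP ?].
Qed.

Lemma mkseq_fiberE n w :
  (fun b => mkseq b n) @^-1` [set w] = if size w == n then cylinder w else set0.
Proof.
have [<-//|wn] := eqVneq (size w) n.
apply/seteqP; split=> // b /= bw; move: wn.
by rewrite -bw size_mkseq eqxx.
Qed.

Lemma cylinders_setI_closed : setI_closed cylinders.
Proof.
suff meet v w : (size v <= size w)%N -> cylinders (cylinder v `&` cylinder w).
  move=> _ _ [->|[v _ <-]] [->|[w _ <-]]; rewrite ?set0I ?setI0; try by left.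
  by have [|/ltnW] := leqP (size v) (size w) => /meet //; rewrite setIC.
move=> vw; rewrite -[w](cat_take_drop (size v)).
have : size (take (size v) w) = size v by rewrite size_takel.
move: (take _ w) (drop _ w) => w1 w2 sz; rewrite cylinder_cat setIA.
have [->|w1v] := eqVneq w1 v.
  by rewrite setIid -cylinder_cat; right; exists (v ++ w2).
left; apply/seteqP; split=> // b [[bv bw1] _]; move: w1v.
by rewrite -bw1 sz bv eqxx.
Qed.

Lemma measurable_cylinder w : measurable (cylinder w : set codes).
Proof. by apply: sub_sigma_algebra; right; exists w. Qed.

Lemma measurable_mkseq_fiber n w :
  measurable ((fun b : codes => mkseq b n) @^-1` [set w]).
Proof. by rewrite mkseq_fiberE; case: ifP => // _; exact: measurable_cylinder. Qed.

Lemma measurable_prefix n (Q : set (seq nat)) :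
  measurable ((fun b : codes => mkseq b n) @^-1` Q).
Proof. by apply: measurable_countable_preimage; exact: measurable_mkseq_fiber. Qed.

Lemma measurable_fun_prefix (d : measure_display) (X : measurableType d) n
  (F : seq nat -> X) : measurable_fun setT (fun b : codes => F (mkseq b n)).
Proof. by move=> _ A _; rewrite setTI; exact: (measurable_prefix n (F @^-1` A)). Qed.

Lemma measurable_fun_codes (d : measure_display) (T : measurableType d)
    (u : nat -> T -> nat) : (forall n a, measurable [set x | u n x = a]) ->
  measurable_fun setT (fun x => u ^~ x : codes).
Proof.
move=> mu; apply: (@measurability _ _ T codes setT _ cylinders) => //.
move=> _ [A [->|[w _ <-]] <-]; rewrite setTI ?preimage_set0 // cylinderE.
rewrite [X in measurable X](_ : _ =
    \bigcap_(j in `I_(size w)) [set x | u j x = nth 0%N w j]) //.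
exact: fin_bigcap_measurable.
Qed.

Lemma measurable_shift_code k : measurable_fun setT (shift_code k : codes -> codes).
Proof.
apply: (measurable_fun_codes (T := codes) (u := fun n b => b (n + k)%N)) => n a.
rewrite [X in measurable X](_ : _ = (fun b : codes => mkseq b (n + k).+1) @^-1`
    [set w | nth 0%N w (n + k) = a]); first exact: measurable_prefix.
by apply/seteqP; split=> b /=; rewrite nth_mkseq.
Qed.

Lemma measurable_prefix_shift n (F : seq nat -> set codes) :
  (forall w, measurable (F w)) ->
  measurable ([set b | F (mkseq b n) (shift_code n b)] : set codes).
Proof.
move=> mF; rewrite [X in measurable X](_ : _ = \bigcup_w
    ((fun b : codes => mkseq b n) @^-1` [set w] `&` shift_code n @^-1` F w)).
  apply: countable_bigcupT_measurable => [|w]; first exact: countableP.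
  apply: measurableI; first exact: measurable_mkseq_fiber.
  by apply: measurable_preimage => //; exact: measurable_shift_code.
apply/seteqP; split=> b; first by move=> Fb; exists (mkseq b n).
by move=> [w _ [/= <-]].
Qed.

End CodeSpace.

Section CodeLaw.
Context {R : realType} {I : finType}.
Variables (K : I -> nat) (p : I -> nat -> R).
Implicit Types (om : nat -> I) (b : nat -> nat) (v w : seq nat).

Definition admissible om : set (nat -> nat) :=
  [set b | forall j, (b j < K (om j))%N].

Lemma admissible_shift om b m : admissible om b ->
  admissible (shiftn m om) (shift_code m b).
Proof. by move=> bK j; exact: bK. Qed.

Lemma measurable_admissible om : measurable (admissible om : set codes).
Proof.
rewrite [X in measurable X](_ : _ = \bigcap_j (fun b : codes => mkseq b j.+1) @^-1`
    [set w | (nth 0%N w j < K (om j))%N]).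
  by apply: bigcapT_measurable => j; exact: measurable_prefix.
by apply/seteqP; split=> b bK j; have := bK j; rewrite /= nth_mkseq //; exact.
Qed.

Lemma mkseq_words om b n : admissible om b -> mkseq b n \in words K om n.
Proof.
move=> bK; elim: n => // n IH; rewrite mkseqS; apply/allpairsP.
by exists (mkseq b n, b n); split; rewrite //= mem_iota bK.
Qed.

Lemma words_uniq om n : uniq (words K om n).
Proof.
elim: n => //= n IH; apply: allpairs_uniq => //; first exact: iota_uniq.
by move=> [v i] [w j] _ _ /= /rcons_inj[-> ->].
Qed.

Lemma size_words om n w : w \in words K om n -> size w = n.
Proof.
elim: n w => [|n IH] w /=; first by rewrite inE => /eqP ->.
by move=> /allpairsP[[v j] [/= vW _ ->]]; rewrite size_rcons (IH v).
Qed.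

Lemma nth_words om n w j : w \in words K om n -> (j < n)%N ->
  (nth 0%N w j < K (om j))%N.
Proof.
elim: n w => // n IH w /allpairsP[[v i] [/= vW]]; rewrite mem_iota => iK ->.
rewrite ltnS leq_eqVlt nth_rcons (size_words vW) => /orP[/eqP->|jn].
  by rewrite ltnn eqxx.
by rewrite jn IH.
Qed.

Definition word_weight om w : R := \prod_(j < size w) pe K p (om j) (nth 0%N w j).

Lemma word_weight_cat om v w :
  word_weight om (v ++ w) = word_weight om v * word_weight (shiftn (size v) om) w.
Proof.
rewrite /word_weight size_cat big_split_ord /=; congr (_ * _).
  by apply: eq_bigr => j _; rewrite nth_cat ltn_ord.
by apply: eq_bigr => j _; rewrite nth_cat ltnNge leq_addr /= addKn addnC.
Qed.

Lemma pu_words om n w : w \in words K om n -> pu p om w = word_weight om w.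
Proof.
move=> wW; apply: eq_bigr => j _; rewrite /pe (nth_words wW) //.
by rewrite -(size_words wW).
Qed.

Definition code_law om (P : set codes -> \bar R) :=
  forall w, P (cylinder w) = (word_weight om w)%:E.

Lemma code_law_setT om (P : set codes -> \bar R) : code_law om P -> P setT = 1%E.
Proof. by move=> lawP; rewrite -cylinder_nil lawP /word_weight big_ord0. Qed.

Lemma code_law_fin_num om (P : {measure set codes -> \bar R}) :
  code_law om P -> fin_num_fun P.
Proof.
by move=> lawP; apply: lty_fin_num_fun; rewrite (code_law_setT lawP) ltry.
Qed.

Lemma word_weight_ge0 om (P : {measure set codes -> \bar R}) w :
  code_law om P -> 0 <= word_weight om w.
Proof. by move=> lawP; rewrite -lee_fin -lawP. Qed.

Lemma ae_admissible om (P : {measure set codes -> \bar R}) :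
  code_law om P -> \forall b \ae P, admissible om b.
Proof.
move=> lawP; apply: ae_foralln => j.
pose prefix (b : codes) := mkseq b j.+1.
have mprefix := measurable_mkseq_fiber j.+1.
pose escaping := prefix @^-1` [set w | (K (om j) <= nth 0%N w j)%N].
have mescaping : measurable escaping by exact: measurable_prefix.
exists escaping; split=> //; last first.
  by move=> b /negP; rewrite -leqNgt /escaping /prefix /= nth_mkseq.
apply/eqP; rewrite eq_le measure_ge0 andbT -(measure0 P).
apply: (le_measure_fibers mprefix) => // w; rewrite set0I measure0.
have [->|/set0P[b [Kb wE]]] := eqVneq (escaping `&` prefix @^-1` [set w]) set0.
  by rewrite measure0.
rewrite mkseq_fiberE -wE size_mkseq eqxx.
apply: le_trans (measureIr _ _ _) _ => //; first exact: measurable_cylinder.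
have jw : (j < size (prefix b))%N by rewrite size_mkseq.
by rewrite [leLHS]lawP /word_weight (bigD1 (Ordinal jw)) //= /pe ltnNge Kb mul0r.
Qed.

Lemma le_measure_admissible om (P : {measure set codes -> \bar R}) (A B : set codes) :
  code_law om P -> measurable A -> measurable B ->
  admissible om `&` A `<=` B -> (P A <= P B)%E.
Proof.
move=> lawP mA mB AB; apply: le_measure_ae => //.
apply: (filterS (F := almost_everywhere P) _ (ae_admissible lawP)) => b bK Ab.
exact: AB.
Qed.

Lemma eq_measure_admissible om (P : {measure set codes -> \bar R}) (A B : set codes) :
  code_law om P -> measurable A -> measurable B ->
  admissible om `&` A = admissible om `&` B -> P A = P B.
Proof.
move=> lawP mA mB AB; apply/eqP; rewrite eq_le !(le_measure_admissible lawP) //.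
  by rewrite -AB; exact: subIsetr.
by rewrite AB; exact: subIsetr.
Qed.

Lemma code_law_shift om (P P' : {measure set codes -> \bar R}) v (A : set codes) :
  code_law om P -> code_law (shiftn (size v) om) P' -> measurable A ->
  P (cylinder v `&` shift_code (size v) @^-1` A) = ((word_weight om v)%:E * P' A)%E.
Proof.
move=> lawP lawP' mA; have mv := measurable_cylinder v.
have mshift := @measurable_shift_code (size v).
pose weight := NngNum (word_weight_ge0 v lawP).
rewrite setIC; apply: (@measure_unique _ _ codes cylinders (fun=> setT) _ _ _ _
  (pushforward (mrestr P mv) (shift_code (size v))) (mscale weight P')) => //.
- exact: cylinders_setI_closed.
- by move=> _; right; exists [::] => //; exact: cylinder_nil.
- by rewrite bigcup_const //; exists 0%N.
- move=> _ [->|[w _ <-]]; first by rewrite !measure0.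
  rewrite -[RHS]/((word_weight om v)%:E * P' (cylinder w))%E lawP' -EFinM.
  by rewrite -word_weight_cat -lawP cylinder_cat setIC.
- by move=> _; rewrite -[ltLHS]/(P (setT `&` cylinder v)) setTI lawP ltry.
Qed.

Lemma code_law_prefix_sum om n (P P' : {measure set codes -> \bar R})
    (F : seq nat -> set codes) :
  code_law om P -> code_law (shiftn n om) P' -> (forall w, measurable (F w)) ->
  P [set b | F (mkseq b n) (shift_code n b)] =
    (\sum_(w <- words K om n) (pu p om w)%:E * P' (F w))%E.
Proof.
move=> lawP lawP' mF; have mFn := measurable_prefix_shift n mF.
have mW := measurable_prefix n [set` words K om n].
transitivity (P ([set b | F (mkseq b n) (shift_code n b)] `&`
    (fun b => mkseq b n) @^-1` [set` words K om n])).
  apply: (eq_measure_admissible lawP) => //; first exact: measurableI.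
  apply/seteqP; split=> b [bK]; last by case.
  by do 2 (split=> //); exact: mkseq_words.
rewrite (measure_fin_fibers (measurable_mkseq_fiber n)) ?words_uniq //.
apply: eq_big_seq => w wW; have wn := size_words wW.
rewrite (pu_words wW) -(code_law_shift lawP) ?wn //; congr (P _).
rewrite mkseq_fiberE wn eqxx.
apply/seteqP; split=> b; rewrite /cylinder /= wn => -[].
  by move=> + bw; rewrite bw.
by move=> bw; rewrite bw.
Qed.

End CodeLaw.

Section Words.
Context {R : realType} {I : finType}.
Variables (lam : I -> R * R) (t : I -> nat -> R * R).
Implicit Types (om : nat -> I) (b : nat -> nat) (v w : seq nat) (z : R * R).

Definition word_disc (Rad : R) om w : set (R * R) :=
  fu lam t om w @` eball (0, 0) Rad.

Lemma fmap0 i j : Defs.fmap lam t i j (0, 0) = t i j.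
Proof.
by rewrite /Defs.fmap /Defs.cadd /cmul; case: (t i j) => x y /=; congr pair; ring.
Qed.

Lemma eq_fword om v w n : (forall j, (j < n)%N -> nth 0%N v j = nth 0%N w j) ->
  fword lam t om v n =1 fword lam t om w n.
Proof.
elim: n => //= n IH vw z; rewrite vw // IH // => j jn.
by rewrite vw // ltnW.
Qed.

Lemma fu_rcons om w j z :
  fu lam t om (rcons w j) z = fu lam t om w (Defs.fmap lam t (om (size w)) j z).
Proof.
rewrite /fu size_rcons /= nth_rcons ltnn eqxx.
by apply: eq_fword => i iw; rewrite nth_rcons iw.
Qed.

Lemma fu_cat om v w z :
  fu lam t om (v ++ w) z = fu lam t om v (fu lam t (shiftn (size v) om) w z).
Proof.
elim/last_ind: w z => [|w j IH] z; first by rewrite cats0.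
by rewrite -rcons_cat !fu_rcons IH size_cat /shiftn addnC.
Qed.

Lemma fu_affine om w z : fu lam t om w z =
  Defs.cadd (fu lam t om w (0, 0)) (cmul (lamprod lam om (size w)) z).
Proof.
elim/last_ind: w z => [|w j IH] z.
  by rewrite /fu /Defs.cadd /cmul /=; case: z => x y /=; congr pair; ring.
rewrite !fu_rcons IH [in RHS]IH size_rcons /Defs.fmap /Defs.cadd /cmul /=.
by congr pair; ring.
Qed.

Lemma cnorm_lamprod om n : cnorm (lamprod lam om n) = \prod_(j < n) rr lam (om j).
Proof.
elim: n => [|n IH]; first by rewrite big_ord0 cnorm_real normr1.
by rewrite /= cnormM IH big_ord_recr.
Qed.

Lemma cnorm_fuB om w z z' : cnorm (fu lam t om w z - fu lam t om w z') =
  \prod_(j < size w) rr lam (om j) * cnorm (z - z').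
Proof.
rewrite fu_affine [fu _ _ _ _ z']fu_affine -cnorm_lamprod -cnormM.
by congr cnorm; rewrite /Defs.cadd /cmul /=; congr pair => /=; ring.
Qed.

Lemma fu_continuous om w : continuous (fu lam t om w).
Proof. by rewrite (funext (fu_affine om w)); exact: affine_continuous. Qed.

Lemma measurable_fu om w : measurable_fun setT (fu lam t om w).
Proof. by rewrite (funext (fu_affine om w)); exact: measurable_affine. Qed.

Lemma measurable_fu_grid_cross om k c r w :
  measurable (fu lam t om w @^-1` grid_cross k c r).
Proof.
rewrite (funext (fu_affine om w)) affine_grid_crossE.
by apply: measurableU; exact: measurable_strip.
Qed.

Lemma fu_mkseq0 om b n : fu lam t om (mkseq b n) (0, 0) =
  (series (fun m => (Yterm lam t om b m).1) n,
   series (fun m => (Yterm lam t om b m).2) n).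
Proof.
elim: n => [|n IH]; first by rewrite /series /= !big_geq.
rewrite mkseqS fu_rcons size_mkseq fmap0 fu_affine size_mkseq IH.
by rewrite /series /= !big_nat_recr.
Qed.

Lemma measurable_Yseries om : measurable_fun setT (Yseries lam t om : codes -> R * R).
Proof.
apply: measurable_fun_pair; apply: measurable_fun_limn => n.
  have := measurable_fun_prefix n (fun w => (fu lam t om w (0, 0)).1).
  by apply: eq_measurable_fun => b _; rewrite fu_mkseq0.
have := measurable_fun_prefix n (fun w => (fu lam t om w (0, 0)).2).
by apply: eq_measurable_fun => b _; rewrite fu_mkseq0.
Qed.

Lemma measurable_Yseries_preimage om (A : set (R * R)) : measurable A ->
  measurable (Yseries lam t om @^-1` A : set codes).
Proof. by apply: measurable_preimage; exact: measurable_Yseries. Qed.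

End Words.

Section CodingMap.
Context {R : realType} {I : finType}.
Variables (K : I -> nat) (lam : I -> R * R) (t : I -> nat -> R * R)
          (p : I -> nat -> R) (Rad : R).
Hypothesis model : planar_model K lam t p Rad.
Implicit Types (om : nat -> I) (b : nat -> nat).

Lemma Rad_gt0 : 0 < Rad.
Proof. by have [_ [_ [_ []]]] := model. Qed.

Lemma rr_gt0 i : 0 < rr lam i.
Proof. by have [_ [/(_ i)/andP[]]] := model. Qed.

Lemma closure_fmap_eball i j : (j < K i)%N ->
  closure (Defs.fmap lam t i j @` eball (0, 0) Rad) `<=` eball (0, 0) Rad.
Proof. by have [_ [_ [_ [_ [+ _]]]]] := model; exact. Qed.

Lemma prod_rr_gt0 om n : 0 < \prod_(j < n) rr lam (om j).
Proof. by apply: prodr_gt0 => j _; exact: rr_gt0. Qed.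

Lemma rr_uniform_bound : exists2 q : R, 0 < q < 1 & forall i, rr lam i <= q.
Proof.
have [_ [rr01 _]] := model.
exists (\big[Num.max/(1 / 2)]_i rr lam i); last by move=> i; exact: le_bigmax.
elim/big_ind: _ => [|x y /andP[x0 x1] /andP[y0 y1]|i _]; [by lra| |exact: rr01].
by rewrite lt_max gt_max x0 x1 y1.
Qed.

Lemma prod_rr_le (q : R) n (i_ : 'I_n -> I) : (forall i, rr lam i <= q) ->
  \prod_(j < n) rr lam (i_ j) <= q ^+ n.
Proof.
move=> rrq; rewrite -[n in leRHS]card_ord -prodr_const.
by apply: ler_prod => j _; rewrite rrq ltW ?rr_gt0.
Qed.

Lemma eball_center : eball (0, 0) Rad (0, 0).
Proof. by apply/eball0E; rewrite cnorm_real normr0 Rad_gt0. Qed.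

Lemma fmap_eball i j z : (j < K i)%N -> eball (0, 0) Rad z ->
  eball (0, 0) Rad (Defs.fmap lam t i j z).
Proof. by move=> jK zB; apply/(closure_fmap_eball jK)/subset_closure; exists z. Qed.

Lemma cnorm_translation_le i j : (j < K i)%N -> cnorm (t i j) <= Rad.
Proof.
by move=> jK; have := fmap_eball jK eball_center; rewrite fmap0 => /eball0E/ltW.
Qed.

Lemma fu_mkseq_eball om b n z : admissible K om b -> eball (0, 0) Rad z ->
  eball (0, 0) Rad (fu lam t om (mkseq b n) z).
Proof.
move=> bK; elim: n z => // n IH z zB.
by rewrite mkseqS fu_rcons size_mkseq; apply/IH/fmap_eball.
Qed.

Lemma fu_dist_center om w z : eball (0, 0) Rad z ->
  `|fu lam t om w z - fu lam t om w (0, 0)| <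
    Rad * \prod_(j < size w) rr lam (om j).
Proof.
move=> zB; apply: le_lt_trans (normr_le_cnorm _) _.
by rewrite cnorm_fuB mulrC ltr_pM2r ?prod_rr_gt0.
Qed.

Lemma Yseries_cvg om b : admissible K om b ->
  fu lam t om (mkseq b n) (0, 0) @[n --> \oo] --> Yseries lam t om b.
Proof.
move=> bK; have [q /andP[q_gt0 q_lt1] rrq] := rr_uniform_bound.
have term_le m : cnorm (Yterm lam t om b m) <= geometric Rad q m.
  rewrite /Yterm cnormM cnorm_lamprod /= mulrC.
  rewrite ler_pM ?cnorm_ge0 ?cnorm_translation_le ?prod_rr_le //.
  by rewrite ltW ?prod_rr_gt0.
have cvg_geo : cvgn (series (geometric Rad q)).
  by apply: is_cvg_geometric_series; rewrite gtr0_norm.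
have cvg_coord (c : R * R -> R) : (forall z, `|c z| <= `|z|) ->
    cvgn (series (fun m => c (Yterm lam t om b m))).
  move=> c_le; apply: normed_cvg; apply: series_le_cvg cvg_geo => m /=.
  - exact: normr_ge0.
  - by rewrite mulr_ge0 ?exprn_ge0 // ltW ?Rad_gt0.
  - exact: le_trans (c_le _) (le_trans (normr_le_cnorm _) (term_le m)).
under eq_cvg do rewrite fu_mkseq0.
apply: (@cvg_pair _ _ _ _ (nbhs _) (nbhs _)); apply: cvg_coord.
  exact: normr_fst_le.
exact: normr_snd_le.
Qed.

Lemma Yseries_shift om b m : admissible K om b -> Yseries lam t om b =
  fu lam t om (mkseq b m) (Yseries lam t (shiftn m om) (shift_code m b)).
Proof.
move=> bK; have cvgY := cvg_comp _ _ (cvg_addnr m) (Yseries_cvg bK).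
have := Yseries_cvg (admissible_shift m bK).
move=> /(continuous_cvg _ (@fu_continuous _ _ lam t om (mkseq b m) _)) cvg_shift.
apply: (cvg_unique _ cvgY) => //.
rewrite [X in X @ _](_ : _ = fu lam t om (mkseq b m) \o
  (fun n => fu lam t (shiftn m om) (mkseq (shift_code m b) n) (0, 0))) //.
by apply/funext => n /=; rewrite addnC mkseqD fu_cat size_mkseq.
Qed.

Lemma Yseries_eball om b : admissible K om b ->
  eball (0, 0) Rad (Yseries lam t om b).
Proof.
move=> bK; apply: (closure_fmap_eball (bK 0%N)).
have cvgY := cvg_comp _ _ (cvg_addnr 1) (Yseries_cvg bK).
apply: (closed_cvg _ _ _ _ cvgY); first exact: closed_closure.
near=> n; apply: subset_closure; rewrite /= addnC mkseqD fu_cat.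
exists (fu lam t (shiftn 1 om) (mkseq (shift_code 1 b) n) (0, 0)) => //.
exact: fu_mkseq_eball (admissible_shift 1 bK) eball_center.
Unshelve. all: by end_near. Qed.

Lemma Yseries_dist_center om b n : admissible K om b ->
  `|Yseries lam t om b - fu lam t om (mkseq b n) (0, 0)| <
    Rad * \prod_(j < n) rr lam (om j).
Proof.
move=> bK; rewrite (Yseries_shift n bK) -[n in X in _ < X](size_mkseq b).
exact/fu_dist_center/Yseries_eball/admissible_shift.
Qed.

Lemma kprime_uniform_bound : exists2 M : R, 0 < M & forall om k kp,
  is_kprime lam Rad om k kp -> 2 ^- k <= M * \prod_(j < kp) rr lam (om j).
Proof.
have [_ [_ [_ [_ [_ Rad_rr]]]]] := model; have Rad2_ge0 := sqr_ge0 Rad.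
exists (8 * Rad ^+ 2 + 1) => [|om k [_|kp [_ /(_ kp (ltnSn _))]]]; first by lra.
  rewrite big_ord0 mulr1 (@le_trans _ _ 1) //; last by lra.
  by rewrite invf_le1 ?exprn_gt0 ?exprn_ege1 ?ler1n.
rewrite big_ord_recr /=; set x := \prod_(_ < kp) _; set r := rr lam _ => k_lt.
have x_gt0 : 0 < x by exact: prod_rr_gt0.
have xr_gt0 : 0 < x * r by rewrite mulr_gt0 ?rr_gt0.
have : 0 < 2 * Rad * x * (2 * Rad * r - 1 / 2).
  by rewrite !mulr_gt0 ?Rad_gt0 // subr_gt0; exact: Rad_rr.
by lra.
Qed.

(* The disc coded by the prefix of length [kp] has diameter at most [2^-k], so it
   meets at most one grid line in each direction: this is the only line that the
   smaller disc coded by the prefix of length [kp + N] can cross. *)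
Lemma Yseries_grid_cross (q : R) om k kp N b :
  (forall i, rr lam i <= q) -> is_kprime lam Rad om k kp -> admissible K om b ->
  ~ (word_disc lam t Rad om (mkseq b (kp + N)) `<=` dyadic k (Yseries lam t om b)) ->
  grid_cross k (fu lam t om (mkseq b kp) (0, 0)) (2 ^- k * q ^+ N)
    (Yseries lam t om b).
Proof.
move=> rrq [kprime_le _] bK /nonsubset[_ [[z zB <-]]] outside.
have y_kp :
    `|fu lam t om (mkseq b (kp + N)) z - fu lam t om (mkseq b kp) (0, 0)| <
    Rad * \prod_(j < kp) rr lam (om j).
  rewrite mkseqD fu_cat -[kp in X in _ < X](size_mkseq b); apply: fu_dist_center.
  by rewrite size_mkseq; apply: fu_mkseq_eball => //; exact: admissible_shift.
apply: grid_cross_of_dyadic_neq (Yseries_dist_center kp bK) y_kp _ outside.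
  by rewrite ler_pdivlMr // mulrC mulrA.
have Y_word := Yseries_dist_center (kp + N) bK.
have := fu_dist_center om (mkseq b (kp + N)) zB.
rewrite size_mkseq distrC => y_word.
apply: le_lt_trans (ler_distD (fu lam t om (mkseq b (kp + N)) (0, 0)) _ _) _.
apply: lt_le_trans (ltrD Y_word y_word) _.
have word_le : \prod_(j < kp + N) rr lam (om j) <=
    \prod_(j < kp) rr lam (om j) * q ^+ N.
  by rewrite big_split_ord /= ler_pM2l ?prod_rr_gt0 // prod_rr_le.
have q_ge0 : 0 <= q := le_trans (ltW (rr_gt0 (om 0%N))) (rrq _).
have := ler_wpM2l (ltW Rad_gt0) word_le.
have := ler_wpM2r (exprn_ge0 N q_ge0) kprime_le.
by lra.
Qed.

End CodingMap.

Section Truncation.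
Context {R : realType} {I : finType}.
Variables (K : I -> nat) (lam : I -> R * R) (t : I -> nat -> R * R)
          (p : I -> nat -> R) (Rad : R)
          (eta : (nat -> I) -> set (R * R) -> \bar R).
Implicit Types (om : nat -> I) (b : nat -> nat) (w : seq nat).

Lemma is_eta_code_law om nu : is_eta K lam t p om nu ->
  exists2 P : probability codes R, code_law K p om P &
    forall A, measurable A -> nu A = P (Yseries lam t om @^-1` A).
Proof.
move=> [d [T [Q [u [mu [lawu nuE]]]]]].
pose X : {mfun T >-> codes} := HB.pack (fun x => u ^~ x : codes)
  (isMeasurableFun.Build _ _ _ _ _ (measurable_fun_codes mu)).
exists (distribution Q X); first by move=> w; rewrite cylinderE -lawu.
move=> A mA; rewrite nuE //; congr (Q _).
by apply/seteqP; split=> x; [move=> /set_mem|move=> Ax; exact/mem_set].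
Qed.

Hypothesis model : planar_model K lam t p Rad.
Hypothesis etaP : forall om, is_eta K lam t p om (eta om).

Lemma eta_setT om : eta om setT = 1%E.
Proof.
have [P _ ->//] := is_eta_code_law (etaP om).
by rewrite preimage_setT probability_setT.
Qed.

Lemma eta_fin_num om A : measurable A -> eta om A \is a fin_num.
Proof.
have [P _ etaE] := is_eta_code_law (etaP om).
move=> mA; rewrite etaE // fin_num_measure //.
exact: measurable_Yseries_preimage.
Qed.

Lemma eta_setU_le om A B : measurable A -> measurable B ->
  (eta om (A `|` B) <= eta om A + eta om B)%E.
Proof.
have [P _ etaE] := is_eta_code_law (etaP om).
move=> mA mB; rewrite !etaE //; last exact: measurableU.
by rewrite preimage_setU; apply: measureU2; exact: measurable_Yseries_preimage.
Qed.

Lemma eta_setC om A : measurable A -> eta om (~` A) = (1 - eta om A)%E.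
Proof.
have [P _ etaE] := is_eta_code_law (etaP om).
move=> mA; rewrite !etaE //; last exact: measurableC.
by rewrite -preimage_setC probability_setC //; exact: measurable_Yseries_preimage.
Qed.

Lemma eta_fu_grid_cross_le om om' C rho k c r w :
  frostman_tubes C rho (eta om') -> 0 < r ->
  (eta om' (fu lam t om w @^-1` grid_cross k c r) <=
    (2 * (C * (r / \prod_(j < size w) rr lam (om j)) `^ rho))%:E)%E.
Proof.
move=> frost r_gt0; rewrite (funext (fu_affine lam t om w)) affine_grid_crossE.
have lam_neq0 : lamprod lam om (size w) != (0, 0).
  by rewrite -cnorm_gt0 cnorm_lamprod (prod_rr_gt0 model).
apply: le_trans (eta_setU_le _ _ _) _; [exact: measurable_strip..|].
rewrite mulr_natl mulr2n EFinD leeD // -cnorm_lamprod.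
  exact: frostman_strip_le.
rewrite [lamprod _ _ _ in X in (_ <= X)%E]surjective_pairing -cnorm_swap.
apply: frostman_strip_le => //; rewrite -cnorm_gt0 cnorm_swap.
by rewrite -surjective_pairing cnorm_gt0.
Qed.

Definition far_points om k n (eps : R) : set (R * R) := [set x |
  eps <= dTV (rawcomp (eta om) (dyadic k x))
             (trunccomp K lam t p eta Rad om n (dyadic k x))].

Lemma far_points_cellE om k n eps : exists C, far_points om k n eps = cell k @^-1` C.
Proof.
exists [set u | eps <= dTV (rawcomp (eta om) (cell k @^-1` [set u]))
  (trunccomp K lam t p eta Rad om n (cell k @^-1` [set u]))].
by apply/seteqP; split=> x; rewrite /far_points /= dyadicE.
Qed.

Lemma measurable_far_points om k n eps : measurable (far_points om k n eps).
Proof.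
have [C ->] := far_points_cellE om k n eps.
by apply: measurable_countable_preimage; exact: measurable_cell.
Qed.

Lemma close_points_gt om k n eps : (eta om (far_points om k n eps) < eps%:E)%E ->
  ((1 - eps)%:E < eta om [set x | (dTV (rawcomp (eta om) (dyadic k x))
    (trunccomp K lam t p eta Rad om n (dyadic k x)) < eps)%R])%E.
Proof.
move=> far_lt; have mfar := measurable_far_points om k n eps.
rewrite [X in eta om X](_ : _ = ~` far_points om k n eps); last first.
  by apply/seteqP; split=> x; rewrite /far_points /= ltNge => /negP.
move: far_lt; rewrite eta_setC // -(fineK (eta_fin_num om mfar)) -EFinB !lte_fin.
by rewrite ltrD2l ltrN2.
Qed.

Section CodeRealization.
Variables (om : nat -> I) (P : {measure set codes -> \bar R}).
Hypothesis lawP : code_law K p om P.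
Hypothesis etaE : forall A, measurable A -> eta om A = P (Yseries lam t om @^-1` A).

Lemma eta_prefix_sum n (B : seq nat -> set (R * R)) : (forall w, measurable (B w)) ->
  P [set b | B (mkseq b n) (Yseries lam t (shiftn n om) (shift_code n b))] =
    (\sum_(w <- words K om n) (pu p om w)%:E * eta (shiftn n om) (B w))%E.
Proof.
move=> mB; have [P' lawP' etaE'] := is_eta_code_law (etaP (shiftn n om)).
have mYB w := measurable_Yseries_preimage lam t (shiftn n om) (mB w).
rewrite (code_law_prefix_sum lawP lawP' mYB).
by apply: eq_bigr => w _; rewrite etaE'.
Qed.

Definition contained_codes n (D : set (R * R)) : set codes := admissible K om `&`
  [set b | word_disc lam t Rad om (mkseq b n) `<=` D].

Lemma measurable_contained_codes n D : measurable (contained_codes n D).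
Proof.
apply: measurableI; first exact: measurable_admissible.
exact: (measurable_prefix n [set w | word_disc lam t Rad om w `<=` D]).
Qed.

Lemma contained_codes_sub n D : contained_codes n D `<=` Yseries lam t om @^-1` D.
Proof.
move=> b [bK bD]; apply: bD; rewrite (Yseries_shift model n bK).
exists (Yseries lam t (shiftn n om) (shift_code n b)) => //.
exact/(Yseries_eball model)/admissible_shift.
Qed.

Lemma contained_words_sumE n D A : measurable A ->
  \sum_(w <- words K om n | `[< word_disc lam t Rad om w `<=` D >])
    pu p om w * fine (eta (shiftn n om) (fu lam t om w @^-1` A)) =
  fine (P (Yseries lam t om @^-1` A `&` contained_codes n D)).
Proof.
move=> mA; pose inside w := `[< word_disc lam t Rad om w `<=` D >].
pose B w := if inside w then fu lam t om w @^-1` A else set0.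
have mfA w : measurable (fu lam t om w @^-1` A).
  by apply: measurable_preimage => //; exact: measurable_fu.
have mB w : measurable (B w) by rewrite /B; case: ifP.
transitivity (fine (P [set b | B (mkseq b n)
    (Yseries lam t (shiftn n om) (shift_code n b))])).
  rewrite (eta_prefix_sum n mB) -[LHS]/(fine (_)%:E) -sumEFin big_mkcond.
  congr fine; apply: eq_bigr => w _; rewrite /B -/(inside w).
  case: ifP => _; first by rewrite EFinM fineK ?eta_fin_num.
  by have [P' _ ->//] := is_eta_code_law (etaP (shiftn n om));
    rewrite preimage_set0 measure0 mule0.
congr fine; apply: (eq_measure_admissible lawP).
- have mYB w := measurable_Yseries_preimage lam t (shiftn n om) (mB w).
  exact: (measurable_prefix_shift n mYB).
- apply: measurableI; first exact: measurable_Yseries_preimage.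
  exact: measurable_contained_codes.
apply/seteqP; split=> b [bK]; rewrite /B.
  rewrite [X in X -> _]/=; case: ifPn => // /asboolP bD.
  by rewrite /= -(Yseries_shift model n bK).
move=> [YA [_ bD]]; split=> //=; rewrite ifT; last exact/asboolP.
by rewrite /= -(Yseries_shift model n bK).
Qed.

Lemma trunccompE n D A : measurable A ->
  trunccomp K lam t p eta Rad om n D A =
  fine (P (Yseries lam t om @^-1` A `&` contained_codes n D)) /
    fine (P (contained_codes n D)).
Proof.
move=> mA; congr (_ / _); first exact: contained_words_sumE.
have := contained_words_sumE n D (@measurableT _ (R * R)%type).
rewrite preimage_setT setTI => <-.
by apply: eq_bigr => w _; rewrite preimage_setT eta_setT mulr1.
Qed.

Lemma dTV_trunccomp_le n D : measurable D ->
  dTV (rawcomp (eta om) D) (trunccomp K lam t p eta Rad om n D) <=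
  fine (P (Yseries lam t om @^-1` D `\` contained_codes n D)) /
    fine (P (Yseries lam t om @^-1` D)).
Proof.
move=> mD; apply: ge_sup; first by eexists; exists set0; [exact: measurable0|].
move=> _ [A mA <-]; rewrite /rawcomp trunccompE // !etaE //; last exact: measurableI.
apply: (conditional_measure_dist (code_law_fin_num lawP)).
- exact: measurable_Yseries_preimage.
- exact: measurable_Yseries_preimage.
- exact: measurable_contained_codes.
- exact: contained_codes_sub.
Qed.

Lemma large_dTV_le n D (eps : R) : measurable D ->
  eps <= dTV (rawcomp (eta om) D) (trunccomp K lam t p eta Rad om n D) ->
  (eps%:E * P (Yseries lam t om @^-1` D) <=
   P (Yseries lam t om @^-1` D `\` contained_codes n D))%E.
Proof.
move=> mD /le_trans/(_ (dTV_trunccomp_le n mD)).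
set E : set codes := _ @^-1` D.
have mE : measurable E by exact: measurable_Yseries_preimage.
have mED : measurable (E `\` contained_codes n D).
  by apply: measurableD => //; exact: measurable_contained_codes.
rewrite -[P E]fineK ?(code_law_fin_num lawP) //.
rewrite -[P (E `\` _)]fineK ?(code_law_fin_num lawP) //.
rewrite -EFinM lee_fin; have [->|PE_neq0] := eqVneq (fine (P E)) 0.
  by rewrite mulr0 fine_ge0.
by rewrite -ler_pdivlMr // lt0r PE_neq0 fine_ge0.
Qed.

(* Markov's inequality, cell by cell. *)
Lemma far_points_le k n eps (S : set codes) : 0 <= eps -> measurable S ->
  (forall b, admissible K om b ->
     ~ contained_codes n (dyadic k (Yseries lam t om b)) b -> S b) ->
  (eps%:E * eta om (far_points om k n eps) <= P S)%E.
Proof.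
move=> eps_ge0 mS leaveS; rewrite etaE; last exact: measurable_far_points.
set far : set codes := _ @^-1` _; have mfar : measurable far.
  by apply: measurable_Yseries_preimage; exact: measurable_far_points.
rewrite -[leLHS]/(mscale (NngNum eps_ge0) P far).
have mcell u : measurable ((cell k \o Yseries lam t om) @^-1` [set u] : set codes).
  rewrite comp_preimage; apply: measurable_Yseries_preimage.
  exact: measurable_cell.
apply: (le_measure_fibers mcell) => // u.
rewrite comp_preimage; set D := cell k @^-1` [set u]; set E := _ @^-1` D.
have [->|/set0P[b [bfar bu]]] := eqVneq (far `&` E) set0; first by rewrite measure0.
have mD : measurable D by exact: measurable_cell.
have dyadic_bE : dyadic k (Yseries lam t om b) = D.
  by rewrite dyadicE (_ : cell k _ = u).
have mE : measurable E by exact: measurable_Yseries_preimage.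
have mED : measurable (E `\` contained_codes n D).
  by apply: measurableD => //; exact: measurable_contained_codes.
apply: (@le_trans _ _ (P (E `\` contained_codes n D))).
  apply: le_trans (large_dTV_le (eps := eps) mD _); last by rewrite -dyadic_bE.
  by apply: lee_wpmul2l; [rewrite lee_fin|exact: measureIr].
apply: (le_measure_admissible lawP) => //; first exact: measurableI.
move=> c [cK [Ec out]]; split=> //; apply: leaveS => //.
by rewrite dyadicE (_ : cell k _ = u).
Qed.

Lemma sum_pu n : \sum_(w <- words K om n) pu p om w = 1.
Proof.
apply/EFin_inj; rewrite -sumEFin -[RHS](code_law_setT lawP).
rewrite [RHS](eta_prefix_sum n (fun=> measurableT)).
by apply: eq_bigr => w _; rewrite eta_setT mule1.
Qed.

Definition near_grid_codes k kp (r : R) : set codes :=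
  [set b | grid_cross k (fu lam t om (mkseq b kp) (0, 0)) r
     (fu lam t om (mkseq b kp) (Yseries lam t (shiftn kp om) (shift_code kp b)))].

Lemma measurable_near_grid_codes k kp r : measurable (near_grid_codes k kp r).
Proof.
apply: (measurable_prefix_shift kp (F := fun w => Yseries lam t (shiftn kp om) @^-1`
  (fu lam t om w @^-1` grid_cross k (fu lam t om w (0, 0)) r))) => w.
by apply: measurable_Yseries_preimage; exact: measurable_fu_grid_cross.
Qed.

Lemma near_grid_codes_le k kp (C rho r : R) :
  frostman_tubes C rho (eta (shiftn kp om)) -> 0 < r ->
  (P (near_grid_codes k kp r) <=
    (2 * (C * (r / \prod_(j < kp) rr lam (om j)) `^ rho))%:E)%E.
Proof.
move=> frost r_gt0; set bound := 2 * _.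
rewrite [P _](eta_prefix_sum kp
  (fun w => measurable_fu_grid_cross lam t om k (fu lam t om w (0, 0)) r w)).
have pu_ge0 w : w \in words K om kp -> (0 <= (pu p om w)%:E)%E.
  by move=> wW; rewrite lee_fin (pu_words p wW) (word_weight_ge0 _ lawP).
rewrite -[leRHS]mul1e -(sum_pu kp) -sumEFin big_seq [in leRHS]big_seq.
rewrite ge0_sume_distrl //; apply: lee_sum => w wW.
apply: lee_wpmul2l; first exact: pu_ge0.
by rewrite /bound -[kp in leRHS](size_words wW); exact: eta_fu_grid_cross_le.
Qed.

End CodeRealization.

Lemma far_points_frostman_le (q M : R) om k kp N (eps C rho : R) :
  0 < q -> (forall i, rr lam i <= q) ->
  0 <= M -> 2 ^- k <= M * \prod_(j < kp) rr lam (om j) ->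
  is_kprime lam Rad om k kp -> frostman_tubes C rho (eta (shiftn kp om)) ->
  0 <= eps -> 0 <= C -> 0 <= rho ->
  (eps%:E * eta om (far_points om k (kp + N) eps) <=
    (2 * C * (q ^+ N * M) `^ rho)%:E)%E.
Proof.
have [P lawP etaE] := is_eta_code_law (etaP om).
move=> q_gt0 rrq M_ge0 k_le kprime frost eps_ge0 C_ge0 rho_ge0.
have r_gt0 : 0 < 2 ^- k * q ^+ N by rewrite mulr_gt0 ?invr_gt0 ?exprn_gt0.
have mnear := measurable_near_grid_codes om k kp (2 ^- k * q ^+ N).
apply: (le_trans (far_points_le lawP etaE (n := kp + N) (k := k) eps_ge0 mnear _)).
  move=> b bK leaves; rewrite /near_grid_codes /= -(Yseries_shift model kp bK).
  by apply: (Yseries_grid_cross model rrq kprime bK) => inside; exact: leaves.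
apply: le_trans (near_grid_codes_le lawP k frost r_gt0) _.
have ratio_gt0 := prod_rr_gt0 model om kp; have qN_gt0 := exprn_gt0 N q_gt0.
rewrite lee_fin mulrA ler_wpM2l ?mulr_ge0 // ge0_ler_powR // ?nnegrE.
- by rewrite divr_ge0 // ltW.
- by rewrite mulr_ge0 // ltW.
- by rewrite ler_pdivrMr // mulrC -mulrA ler_pM2l.
Qed.

End Truncation.

Theorem lemma3p14 (R : realType) (I : finType) (K : I -> nat)
  (lam : I -> R * R) (t : I -> nat -> R * R) (p : I -> nat -> R) (Rad : R)
  (eta : (nat -> I) -> set (R * R) -> \bar R) :
  planar_model K lam t p Rad ->
  (forall om, is_eta K lam t p om (eta om)) ->
  forall eps C rho : R, 0 < eps -> 0 < C -> 0 < rho ->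
  exists Neps : nat,
    forall (om : nat -> I) (k kp : nat),
      is_kprime lam Rad om k kp ->
      frostman_tubes C rho (eta (shiftn kp om)) ->
      forall n : nat, n = (kp + Neps)%N ->
        ((1 - eps)%:E <
         eta om [set x | (dTV (rawcomp (eta om) (dyadic k x))
                             (trunccomp K lam t p eta Rad om n (dyadic k x)) < eps)%R])%E.
Proof.
move=> model etaP eps C rho eps_gt0 C_gt0 rho_gt0.
have [q /andP[q_gt0 q_lt1] rrq] := rr_uniform_bound model.
have [M M_gt0 kprime_le] := kprime_uniform_bound model.
have [N N_large] : exists N, 2 * C * (q ^+ N * M) `^ rho < eps * eps.
  by apply: powR_geometric_lt; rewrite ?mulr_gt0 ?ltW ?q_gt0.
exists N => om k kp kprime frost _ ->.
apply: (close_points_gt etaP); rewrite -(@lte_pmul2l _ eps%:E) // -EFinM.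
by apply: le_lt_trans (far_points_frostman_le model etaP N q_gt0 rrq (ltW M_gt0)
  (kprime_le _ _ _ kprime) kprime frost _ _ _) _; rewrite ?ltW.
Qed.
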